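(* Let $D\in[0,\infty]$, let $I$ be an index set, and let $x_i\in\mathbb{E}$, $g_i\in\mathbb{E}^*$, $f_i\in\mathbb{R}$ for $i\in I$. The set $\{(x_i,g_i,f_i)\}_{i\in I}$ is $\mathcal{I}_D$-interpolable (resp. $\mathcal{I}'_D$-interpolable), i.e. interpolable by a $D$-bounded indicator function, if and only if the following hold for every pair of indices $i\in I$ and $j\in I$: $$f_i=0,$$ $$\langle g_j,x_i-x_j\rangle\leq 0,$$ $$\|x_i\|_{\mathbb{E}}\leq D\qquad(\text{resp. }\|x_j-x_i\|_{\mathbb{E}}\leq D).$$
   Context: $\mathbb{E}$ is a finite-dimensional real vector space with dual $\mathbb{E}^*$, $\langle\cdot,\cdot\rangle:\mathbb{E}^*\times\mathbb{E}\to\mathbb{R}$ is a dual pairing (nondegenerate bilinear map), $B:\mathbb{E}\to\mathbb{E}^*$ is a self-adjoint positive definite linear operator, and $\|x\|_{\mathbb{E}}^2=\langle Bx,x\rangle$ for $x\in\mathbb{E}$. $\mathcal{I}_D(\mathbb{E})$ is the set of proper, closed, convex functions $f:\mathbb{E}\to\{0,\infty\}$ (indicator functions of nonempty closed convex sets) such that $\|x\|_{\mathbb{E}}\leq D$ for all $x$ in the domain $\{x:f(x)=0\}$. $\mathcal{I}'_D(\mathbb{E})$ is defined in the same way, but with the condition $\|x_1-x_2\|_{\mathbb{E}}\leq D$ for all $x_1,x_2$ in the domain. ($D=\infty$ means no boundedness requirement.) For a class $\mathcal{F}(\mathbb{E})$ of convex functions, a set $\{(x_i,g_i,f_i)\}_{i\in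 I}\subset\mathbb{E}\times\mathbb{E}^*\times\mathbb{R}$ is $\mathcal{F}$-interpolable if there exists $F\in\mathcal{F}(\mathbb{E})$ such that $g_i\in\partial F(x_i)$ and $F(x_i)=f_i$ for all $i\in I$, where $\partial F$ is the convex subdifferential (with respect to the pairing $\langle\cdot,\cdot\rangle$). *)

(* Defs.v *)
From HB Require Import structures.
From mathcomp Require Import all_boot all_order all_algebra.
From mathcomp Require Import all_classical all_reals all_analysis.

Set Implicit Arguments.
Unset Strict Implicit.
Unset Printing Implicit Defensive.

Import Order.TTheory GRing.Theory Num.Theory.
Import numFieldNormedType.Exports.

Local Open Scope classical_set_scope.
Local Open Scope ring_scope.

(* [Es] plays the role of the dual space of [E]: a finite-dimensional space put
   in duality with [E] by the nondegenerate pairing [pr]. *)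
Section Setting.
Context {R : realType} {E Es : vectType R}.
Variable pr : {bilinear Es -> E -> R | *%R & *%R}.

Definition nondegenerate_pairing : Prop :=
  (forall g : Es, (forall x : E, pr g x = 0) -> g = 0) /\
  (forall x : E, (forall g : Es, pr g x = 0) -> x = 0).

Variable B : {linear E -> Es}.

Definition self_adjoint : Prop := forall x y : E, pr (B x) y = pr (B y) x.

Definition positive_definite : Prop :=
  forall x : E, x != 0 -> 0 < pr (B x) x.

Definition normE (x : E) : R := Num.sqrt (pr (B x) x).

End Setting.

Section ExtendedRealFunctions.
Context {R : realType} {E : vectType R}.
Implicit Types F : E -> \bar R.

(* A [vectType] has no topology in the library: [E] gets the one transported
   from 'rV[R]_n by its coordinates, which is the unique Hausdorff vector
   space topology of [E], hence also the topology of any norm on [E]. *)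
Definition vect_topology : topologicalType :=
  initial_topology (@VectorInternalTheory.v2r R E).

Definition effective_domain F : set E := [set x | (F x < +oo)%E].

Definition epigraph F : set (E * R) := [set p | (F p.1 <= p.2%:E)%E].

Definition proper_fun F : Prop :=
  (forall x, F x != -oo%E) /\ effective_domain F !=set0.

Definition closed_fun F : Prop :=
  closed (epigraph F : set (vect_topology * R)%type).

Definition convex_fun F : Prop :=
  forall (x y : E) (t : R), 0 < t < 1 ->
    (F (t *: x + (1 - t) *: y)%R <= t%:E * F x + (1 - t)%:E * F y)%E.

Definition indicator_fun F : Prop :=
  [/\ forall x, F x = 0%E \/ F x = +oo%E,
      proper_fun F, closed_fun F & convex_fun F].

End ExtendedRealFunctions.

Section Classes.
Context {R : realType} {E Es : vectType R}.
Variable pr : {bilinear Es -> E -> R | *%R & *%R}.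

Definition indicator_class (B : {linear E -> Es}) (D : \bar R) :
    set (E -> \bar R) :=
  [set F | indicator_fun F /\
           forall x, effective_domain F x -> ((normE pr B x)%:E <= D)%E].

Definition indicator_class' (B : {linear E -> Es}) (D : \bar R) :
    set (E -> \bar R) :=
  [set F | indicator_fun F /\
           forall x1 x2, effective_domain F x1 -> effective_domain F x2 ->
             ((normE pr B (x1 - x2)%R)%:E <= D)%E].

Definition subdifferential (F : E -> \bar R) (x : E) : set Es :=
  [set g | forall y : E, (F x + (pr g (y - x)%R)%:E <= F y)%E].

Definition interpolable (C : set (E -> \bar R)) (I : Type)
    (x : I -> E) (g : I -> Es) (f : I -> R) : Prop :=
  exists2 F, C F &
    forall i : I, subdifferential F (x i) (g i) /\ F (x i) = (f i)%:E.

End Classes.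

(* Main.v *)
(** Both classes are handled by exhibiting the domain [K] of the indicator as
    an intersection of half-spaces of [E]; such a set is closed and convex.
    Norm balls are of this form by Cauchy-Schwarz.  For the radius-[D] class
    take [K] to be the solutions of all inequalities [<g_j, z - x_j> <= 0]
    inside the ball of radius [D].  For the diameter-[D] class, replace the ball
    by the ball hull of [A = {x_i}]: the set of the points within [D] of every
    point [w] that is itself within [D] of all of [A].  As [A] has diameter at
    most [D], its points are such [w], hence so are the points of the hull,
    which therefore again has diameter at most [D]. *)

Require Import Defs.
From HB Require Import structures.
From mathcomp Require Import all_boot all_order all_algebra.
From mathcomp Require Import all_classical all_reals all_analysis.
From mathcomp Require Import lra.

Import Order.TTheory GRing.Theory Num.Theory.
Import numFieldNormedType.Exports.
Import VectorInternalTheory.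

Local Open Scope classical_set_scope.
Local Open Scope ring_scope.

(** * Indicators of closed convex sets *)

Section Indicators.
Context {R : realType} {E : vectType R}.
Implicit Types K : set E.

Definition closed_convex K : Prop :=
  closed (K : set (vect_topology (R := R) (E := E))) /\
  forall (x y : E) (t : R), 0 < t < 1 -> K x -> K y ->
    K (t *: x + (1 - t) *: y).

Definition indicator K : E -> \bar R :=
  fun x => if `[< K x >] then 0%E else +oo%E.

Lemma indicator_in {K x} : K x -> indicator K x = 0%E.
Proof. by move=> Kx; rewrite /indicator asboolT. Qed.

Lemma indicator_out {K x} : ~ K x -> indicator K x = +oo%E.
Proof. by move=> Kx; rewrite /indicator asboolF. Qed.

Lemma effective_domain_indicator K : effective_domain (indicator K) = K.
Proof.
apply/seteqP; split => x; rewrite /effective_domain /=; last first.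
  by move=> /indicator_in ->; rewrite ltry.
by case: (pselect (K x)) => // /indicator_out ->; rewrite ltxx.
Qed.

Lemma closed_convex_bigcap (J : Type) (S : set J) (K : J -> set E) :
  (forall j, S j -> closed_convex (K j)) ->
  closed_convex (\bigcap_(j in S) K j).
Proof.
move=> KP; split; first by apply: closed_bigI => j /KP[].
move=> x y t t01 Kx Ky j Sj; have [_] := KP _ Sj.
by apply=> //; [exact: Kx|exact: Ky].
Qed.

Lemma closed_convexI K1 K2 :
  closed_convex K1 -> closed_convex K2 -> closed_convex (K1 `&` K2).
Proof.
move=> [c1 v1] [c2 v2]; split; first exact: closedI.
by move=> x y t t01 [? ?] [? ?]; split; [exact: v1|exact: v2].
Qed.

Lemma closed_convexT : closed_convex [set: E].
Proof. by split=> //; exact: closedT. Qed.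

Lemma indicator_fun_indicator K :
  K !=set0 -> closed_convex K -> indicator_fun (indicator K).
Proof.
move=> K0 [Kclosed Kconvex]; split.
- move=> x; case: (pselect (K x)) => [/indicator_in|/indicator_out] ->;
    by [left|right].
- split; last by rewrite effective_domain_indicator.
  by move=> x; case: (pselect (K x)) => [/indicator_in|/indicator_out] ->.
- rewrite /closed_fun.
  (* The epigraph is the cylinder over [K] with fibre the nonnegative reals, an intersection of
     preimages of closed sets under the two projections. *)
  have -> : epigraph (indicator K) =
      (fst @^-1` K) `&` (snd @^-1` [set r | 0 <= r]).
    apply/seteqP; split => -[x r] /=; rewrite /epigraph /=.
      case: (pselect (K x)) => [Kx|Kx]; first by rewrite indicator_in.
      by rewrite indicator_out.
    by move=> [/indicator_in ->].
  apply: closedI.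
    by refine (preimage_closed _ Kclosed) => p _; exact: cvg_fst.
  by refine (preimage_closed _ (@closed_ge R 0)) => p _; exact: cvg_snd.
(* Both weights are strictly positive, so an endpoint outside [K] makes the right-hand side [+oo];
   only the case of two endpoints in [K] uses convexity of [K]. *)
- move=> x y t /[dup] t01 /andP[t0 t1].
  have s0 : 0 < 1 - t by rewrite subr_gt0.
  case: (pselect (K x)) => Kx; last first.
    rewrite (indicator_out Kx) gt0_muley ?lte_fin// addye ?leey//.
    case: (pselect (K y)) => [/indicator_in|/indicator_out] ->.
      by rewrite mule0.
    by rewrite gt0_muley ?lte_fin.
  case: (pselect (K y)) => Ky; last first.
    by rewrite (indicator_in Kx) (indicator_out Ky) mule0 add0e
      gt0_muley ?lte_fin// leey.
  by rewrite !indicator_in ?mule0 ?adde0//; exact: Kconvex.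
Qed.

End Indicators.

(** * Continuity of the pairing and half-spaces *)

Section HalfSpaces.
Context {R : realType} {E Es : vectType R}.
Variable pr : {bilinear Es -> E -> R | *%R & *%R}.

(** The topology is initial for the coordinate map [v2r], so it suffices to factor [pr g] through it
    as a finite linear combination of coordinates. *)
Lemma pairing_continuous (g : Es) :
  continuous (pr g : vect_topology (R := R) (E := E) -> R).
Proof.
have -> : (pr g : E -> R) = (fun u : 'rV[R]_(dim E) =>
    \sum_i u 0 i * pr g (r2v (delta_mx 0 i)))
      \o @v2r R E.
  apply/funext => z /=.
  rewrite -[in LHS](v2rK z).
  rewrite [in LHS](row_sum_delta (v2r z)).
  rewrite linear_sum linear_sumr; apply: eq_bigr => i _.
  by rewrite linearZ linearZr_LR.
move=> z; apply: continuous_comp; first exact: initial_continuous.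
apply: continuous_big => [[a b]|i _ u]; first exact: add_continuous.
by apply: continuousM; [exact: coord_continuous|exact: cst_continuous].
Qed.

Lemma closed_convex_halfspace (g : Es) (a : R) :
  closed_convex [set z : E | pr g z <= a].
Proof.
split.
  refine (preimage_closed _ (@closed_le R a)) => z _.
  exact: pairing_continuous.
move=> x y t /andP[t0 t1] /= xa ya.
rewrite linearDr !linearZr_LR /=; nra.
Qed.

End HalfSpaces.

(** * Norm balls and sets of bounded diameter *)

Section Balls.
Context {R : realType} {E Es : vectType R}.
Context {pr : {bilinear Es -> E -> R | *%R & *%R}} {B : {linear E -> Es}}.
Hypothesis Bsym : self_adjoint pr B.
Hypothesis Bpos : positive_definite pr B.

Lemma form_ge0 (x : E) : 0 <= pr (B x) x.
Proof.
have [->|/Bpos/ltW//] := eqVneq x 0.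
by rewrite linear0r.
Qed.

Lemma normE_ge0 (x : E) : 0 <= normE pr B x.
Proof. exact: sqrtr_ge0. Qed.

Lemma normE0 : normE pr B 0 = 0.
Proof. by rewrite /normE linear0r sqrtr0. Qed.

Lemma sqr_normE (x : E) : normE pr B x ^+ 2 = pr (B x) x.
Proof. by rewrite sqr_sqrtr// form_ge0. Qed.

Lemma normEN (x : E) : normE pr B (- x) = normE pr B x.
Proof. by rewrite /normE (linearN B) linearNl linearNr opprK. Qed.

Lemma normE_eq0 (x : E) : normE pr B x = 0 -> x = 0.
Proof.
move=> Nx0; apply/eqP; apply: contraT => /Bpos.
by rewrite -sqr_normE Nx0 expr0n ltxx.
Qed.

Lemma cauchy_schwarz (w z : E) :
  pr (B w) z <= normE pr B w * normE pr B z.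
Proof.
have [/normE_eq0 ->|w0] := eqVneq (normE pr B w) 0.
  by rewrite (linear0 B) linear0l normE0 mul0r.
have [/normE_eq0 ->|z0] := eqVneq (normE pr B z) 0.
  by rewrite linear0r normE0 mulr0.
have ab : 0 < normE pr B w * normE pr B z.
  by rewrite mulr_gt0// lt_neqAle normE_ge0 eq_sym ?w0 ?z0.
(* With a, b the norms of [w], [z] and p their product under the form, this expands to 0 <= 2ab(ab -
   p), and ab > 0 can be cancelled. *)
have := form_ge0 (normE pr B z *: w - normE pr B w *: z).
rewrite (linearB B) !(linearZ_LR B) linearBl !linearBr.
rewrite !linearZl_LR !linearZr_LR /=.
rewrite -!sqr_normE (Bsym z w).
set a := normE pr B w in ab *; set b := normE pr B z in ab *.
set p := pr _ _ => H; rewrite /GRing.scale /= in H.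
rewrite -(ler_pM2l ab); lra.
Qed.

Lemma closed_convex_ball (c : E) (D : \bar R) : (0 <= D)%E ->
  closed_convex [set z | ((normE pr B (z - c))%:E <= D)%E].
Proof.
case: D => [r r0| _|//]; last first.
  rewrite (_ : [set _ | _] = [set: E]); first exact: closed_convexT.
  by apply/seteqP; split => z //= _; rewrite leey.
rewrite lee_fin in r0.
have -> : [set z | ((normE pr B (z - c))%:E <= r%:E)%E] =
    \bigcap_(w in [set: E])
      [set z | pr (B w) z <= normE pr B w * r + pr (B w) c].
  apply/seteqP; split => z /=; rewrite lee_fin.
    move=> zr w _ /=; rewrite -lerBlDr -linearBr.
    by apply: le_trans (cauchy_schwarz _ _) _; rewrite ler_wpM2l ?normE_ge0.
  (* The half-space with normal [B (z - c)] already suffices: it bounds the squared norm of [z - c]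
     by [r] times that norm, which is cancelled unless it is zero. *)
  move=> /(_ (z - c) I) /=; rewrite -lerBlDr -linearBr -sqr_normE expr2.
  have [->//|n0] := eqVneq (normE pr B (z - c)) 0.
  by rewrite ler_pM2l// lt_neqAle normE_ge0 eq_sym n0.
by apply: closed_convex_bigcap => w _; exact: closed_convex_halfspace.
Qed.

Lemma bounded_diameter_hull {A : set E} {D : \bar R} : (0 <= D)%E -> A !=set0 ->
  (forall a b, A a -> A b -> ((normE pr B (a - b))%:E <= D)%E) ->
  exists2 K, closed_convex K /\ A `<=` K &
    forall a b, K a -> K b -> ((normE pr B (a - b))%:E <= D)%E.
Proof.
move=> D0 [a0 Aa0] AD.
pose W := [set w | forall a, A a -> ((normE pr B (a - w))%:E <= D)%E].
pose K := \bigcap_(w in W) [set z | ((normE pr B (z - w))%:E <= D)%E].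
have AW : A `<=` W by move=> a Aa b Ab; exact: AD.
have KW : K `<=` W.
  by move=> z Kz a Aa; rewrite -normEN opprB; exact: Kz (AW _ Aa).
exists K; last by move=> a b Ka Kb; exact: Ka (KW _ Kb).
split; last by move=> a Aa w Ww; exact: Ww.
by apply: closed_convex_bigcap => w _; exact: closed_convex_ball.
Qed.

End Balls.

(** * Interpolation conditions and the choice of the domain *)

Lemma interpolable_indicator (R : realType) (E Es : vectType R)
    (pr : {bilinear Es -> E -> R | *%R & *%R}) (C : set (E -> \bar R))
    (K : set E) (I : Type) (x : I -> E) (g : I -> Es) (f : I -> R) :
  C (indicator K) -> (forall i, K (x i)) -> (forall i, f i = 0) ->
  (forall i z, K z -> pr (g i) (z - x i) <= 0) ->
  interpolable pr C x g f.
Proof.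
move=> CK Kx f0 gK; exists (indicator K) => // i.
rewrite indicator_in// f0; split=> // z; rewrite indicator_in// add0e.
(* Off [K] the subgradient inequality is trivial, its right-hand side being [+oo]. *)
case: (pselect (K z)) => [Kz|/indicator_out ->]; last exact: leey.
by rewrite indicator_in// lee_fin gK.
Qed.

(** A finite value of an indicator is 0; the sign condition is then the subgradient inequality at
    [x j] tested at [x i]. *)
Lemma interpolable_necessary {R : realType} {E Es : vectType R}
    {pr : {bilinear Es -> E -> R | *%R & *%R}} {F : E -> \bar R}
    {I : Type} {x : I -> E} {g : I -> Es} {f : I -> R} :
  indicator_fun F ->
  (forall i, subdifferential pr F (x i) (g i) /\ F (x i) = (f i)%:E) ->
  forall i j,
    [/\ f i = 0, pr (g j) (x i - x j) <= 0 & effective_domain F (x i)].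
Proof.
move=> [F01 _ _ _] Fx.
have f0 i : f i = 0.
  by have [_ Fi] := Fx i; have := F01 (x i); rewrite Fi => -[[]|].
have Fx0 i : F (x i) = 0%E by have [_ ->] := Fx i; rewrite f0.
move=> i j; split=> //; last by rewrite /effective_domain /= Fx0 ltry.
have [/(_ (x i)) + _] := Fx j.
by rewrite !Fx0 add0e lee_fin.
Qed.

Theorem theorem3p6 (R : realType) (E Es : vectType R)
    (pr : {bilinear Es -> E -> R | *%R & *%R}) (B : {linear E -> Es})
    (pr_nondegenerate : nondegenerate_pairing pr)
    (B_self_adjoint : self_adjoint pr B)
    (B_positive_definite : positive_definite pr B)
    (D : \bar R) (D_ge0 : (0 <= D)%E)
    (I : Type) (x : I -> E) (g : I -> Es) (f : I -> R) :
  (interpolable pr (indicator_class pr B D) x g f <->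
   forall i j : I,
     [/\ f i = 0,
         pr (g j) (x i - x j) <= 0 &
         ((normE pr B (x i))%:E <= D)%E]) /\
  (interpolable pr (indicator_class' pr B D) x g f <->
   forall i j : I,
     [/\ f i = 0,
         pr (g j) (x i - x j) <= 0 &
         ((normE pr B (x j - x i)%R)%:E <= D)%E]).
Proof.
(* [G] is the largest set to which every [g j] is normal at [x j], so any admissible domain lies
   inside it. *)
pose G := \bigcap_(j in [set: I]) [set z | pr (g j) z <= pr (g j) (x j)].
have GP z : G z <-> forall j, pr (g j) (z - x j) <= 0.
  split=> Gz j; last by move=> _ /=; rewrite -subr_le0 -linearBr.
  by rewrite linearBr subr_le0; exact: Gz.
have Gcc : closed_convex G.
  by apply: closed_convex_bigcap => j _; exact: closed_convex_halfspace.
split; split.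
- move=> [F [Find FD] Fx] i j.
  by have [? ? /FD] := interpolable_necessary Find Fx i j.
- move=> H.
  pose K := G `&` [set z | ((normE pr B (z - 0))%:E <= D)%E].
  have Kx i : K (x i).
    split; last by rewrite /= subr0; have [] := H i i.
    by apply/GP => j; have [] := H i j.
  (* When [I] is empty, [G] is the whole space and 0 lies in the ball since [D] is nonnegative. *)
  have K0 : K !=set0.
    have [[i]|noI] := pselect (inhabited I); first by exists (x i).
    exists 0; split; last by rewrite /= subr0 normE0.
    by move=> j; exfalso; exact: noI.
  apply: (@interpolable_indicator _ _ _ _ _ K) => //.
  + split; last first.
      by move=> z; rewrite effective_domain_indicator => -[_]; rewrite /= subr0.
    apply: indicator_fun_indicator => //.
    by apply: closed_convexI => //; exact: closed_convex_ball.
  + by move=> i; have [] := H i i.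
  + by move=> i z [/GP].
- move=> [F [Find FD] Fx] i j.
  have [? ? Fi] := interpolable_necessary Find Fx i j.
  by have [_ _ Fj] := interpolable_necessary Find Fx j i; split=> //; exact: FD.
- move=> H.
  have f0 i : f i = 0 by have [] := H i i.
  (* A domain has to be nonempty, hence the point 0 when I is empty. *)
  pose A := [set z | (exists i, z = x i) \/ (~ inhabited I /\ z = 0)].
  have A0 : A !=set0.
    have [[i]|noI] := pselect (inhabited I); last by exists 0; right.
    by exists (x i); left; exists i.
  have AD a b : A a -> A b -> ((normE pr B (a - b))%:E <= D)%E.
    move=> [[i ->]|[noI ->]] [[j ->]|[noI' ->]].
    + by have [] := H j i.
    + by case: noI'.
    + by case: noI.
    + by rewrite subr0 normE0.
  have [K [Kcc AK] KD] :=
    bounded_diameter_hull B_self_adjoint B_positive_definite D_ge0 A0 AD.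
  have AG : A `<=` G.
    move=> a [[i ->]|[noI _]]; last by move=> j; exfalso; exact: noI.
    by apply/GP => j; have [] := H i j.
  (* The hull [K] controls only the diameter; cutting it by [G] restores the subgradient conditions
     and loses no point of [A]. *)
  apply: (@interpolable_indicator _ _ _ _ _ (G `&` K)) => //.
  + split; last first.
      rewrite effective_domain_indicator => y z [_ Ky] [_ Kz]; exact: KD.
    apply: indicator_fun_indicator; last exact: closed_convexI.
    by have [a Aa] := A0; exists a; split; [exact: AG|exact: AK].
  + by move=> i; split; [apply: AG|apply: AK]; left; exists i.
  + by move=> i z [/GP].
Qed.
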